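(* For every integer $n\ge 1$ and all $f,g\in\mathcal H_n$, $$\langle f,g\rangle_H=\langle f,g\rangle_n=\langle f,g\rangle_n^{*},$$ where $$\langle f,g\rangle_H=\frac1{|\Omega|}\int_\Omega f(\mathbf t)\overline{g(\mathbf t)}\,d\mathbf t,\qquad \langle f,g\rangle_n=\frac1{3n^2}\sum_{\mathbf j\in\mathbb H_n}f(\tfrac{\mathbf j}{n})\overline{g(\tfrac{\mathbf j}{n})},\qquad \langle f,g\rangle_n^{*}=\frac1{3n^2}\sum_{\mathbf j\in\mathbb H_n^*}c_{\mathbf j}^{(n)}f(\tfrac{\mathbf j}{n})\overline{g(\tfrac{\mathbf j}{n})}.$$
   Context: $\mathbb R^3_H=\{\mathbf t=(t_1,t_2,t_3)\in\mathbb R^3:t_1+t_2+t_3=0\}$, $\mathbb H=\mathbb Z^3\cap\mathbb R^3_H$. The hexagon is $\Omega=\{\mathbf t\in\mathbb R^3_H:-1\le t_1,t_2,-t_3<1\}$, $d\mathbf t$ is area measure on the plane $\mathbb R^3_H$ and $|\Omega|$ is the area of $\Omega$. For $\mathbf j\in\mathbb H$, $\phi_{\mathbf j}(\mathbf t)=e^{\frac{2\pi i}{3}\mathbf j\cdot\mathbf t}$. Index sets: $\mathbb H_n=\{\mathbf j\in\mathbb H:-n\le j_1,j_2,-j_3<n\}$, $\mathbb H_n^*=\{\mathbf j\in\mathbb H:-n\le j_1,j_2,j_3\le n\}$, $\mathbb H_n^\circ=\{\mathbf j\in\mathbb H:-n<j_1,j_2,j_3<n\}$. $\mathcal H_n=\mathrm{span}_{\mathbb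 C}\{\phi_{\mathbf j}:\mathbf j\in\mathbb H_n\}$ (functions on $\mathbb R^3_H$). The weights are $c_{\mathbf j}^{(n)}=1$ if $\mathbf j\in\mathbb H_n^\circ$; $c_{\mathbf j}^{(n)}=\frac12$ if $\mathbf j\in\mathbb H_n^*\setminus\mathbb H_n^\circ$ and $j_1j_2j_3\ne0$; $c_{\mathbf j}^{(n)}=\frac13$ if $\mathbf j\in\mathbb H_n^*\setminus\mathbb H_n^\circ$ and $j_1j_2j_3=0$. *)

(* Defs.v *)
From HB Require Import structures.
From mathcomp Require Import all_boot all_order all_algebra.
From mathcomp Require Import all_classical all_reals all_analysis.
From mathcomp Require Import measurable_realfun complex zify ring lra.

Set Implicit Arguments.
Unset Strict Implicit.
Unset Printing Implicit Defensive.

Import Order.TTheory GRing.Theory Num.Theory.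

Local Open Scope classical_set_scope.
Local Open Scope ring_scope.
Local Open Scope complex_scope.

(** Points of R^3 and of Z^3 are triples ((x1, x2), x3).  A function on the
    plane [planeH] is represented by a function on R^3, of which only the
    values on [planeH] are ever used. *)

Notation R2 R := (measurableTypeR R * measurableTypeR R)%type.
Notation R3 R :=
  (measurableTypeR R * measurableTypeR R * measurableTypeR R)%type.
Notation Z3 := (int * int * int)%type.

Section Geometry.
Variable R : realType.

Definition planeH : set (R3 R) := [set t | t.1.1 + t.1.2 + t.2 = 0].

Definition Omega : set (R3 R) :=
  [set t | planeH t /\
    [/\ -1 <= t.1.1 < 1, -1 <= t.1.2 < 1 & -1 <= - t.2 < 1]].

(** Coordinates on [planeH] in the orthonormal basis
    (1, -1, 0) / sqrt 2,  (1, 1, -2) / sqrt 6. *)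
Definition chart (u : R2 R) : R3 R :=
  let a := u.1 / Num.sqrt 2 in
  let b := u.2 / Num.sqrt 6 in
  (a + b, - a + b, - (2 * b)).

Lemma chart_isometry (u v : R2 R) :
  ((chart u).1.1 - (chart v).1.1) ^+ 2 + ((chart u).1.2 - (chart v).1.2) ^+ 2
    + ((chart u).2 - (chart v).2) ^+ 2
  = (u.1 - v.1) ^+ 2 + (u.2 - v.2) ^+ 2.
Proof.
case: u v => [x y] [x' y'] /=.
have h2 : (Num.sqrt 2 : R)^-1 ^+ 2 = 2^-1 by rewrite exprVn sqr_sqrtr.
have h6 : (Num.sqrt 6 : R)^-1 ^+ 2 = 6^-1 by rewrite exprVn sqr_sqrtr.
transitivity (2 * (Num.sqrt 2 : R)^-1 ^+ 2 * (x - x') ^+ 2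
              + 6 * (Num.sqrt 6 : R)^-1 ^+ 2 * (y - y') ^+ 2); first by ring.
by rewrite h2 h6; field.
Qed.

Lemma range_chart : range chart = planeH.
Proof.
apply/seteqP; split => [_ [[x y] _ <-]|[[a b] c]]; rewrite /planeH /=.
  by ring.
move=> h; exists ((a - b) / 2 * Num.sqrt 2, (a + b) / 2 * Num.sqrt 6) => //.
have n2 : (Num.sqrt 2 : R) != 0 by rewrite sqrtr_eq0 -ltNge.
have n6 : (Num.sqrt 6 : R) != 0 by rewrite sqrtr_eq0 -ltNge.
rewrite /chart /= !mulfK//.
have -> : c = - (a + b) by apply/eqP; rewrite -addr_eq0 addrC h.
by congr (_, _, _); field.
Qed.

Lemma measurable_chart : measurable_fun setT chart.
Proof.
have m1 : measurable_fun setT (fun u : R2 R => u.1 / Num.sqrt 2 : R).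
  apply: (@measurable_funM _ _ _ _ (fun u : R2 R => u.1 : R)) => //.
  exact: measurable_fst.
have m2 : measurable_fun setT (fun u : R2 R => u.2 / Num.sqrt 6 : R).
  apply: (@measurable_funM _ _ _ _ (fun u : R2 R => u.2 : R)) => //.
  exact: measurable_snd.
apply: measurable_fun_pair; first apply: measurable_fun_pair.
- exact: measurable_funD.
- by apply: measurable_funD => //; exact: measurableT_comp.
- apply: measurableT_comp => //.
  exact: (@measurable_funM _ _ _ _ (cst 2)).
Qed.

HB.instance Definition _ := isMeasurableFun.Build _ _ _ _ chart measurable_chart.

(** Area measure of the plane [planeH], as a measure on R^3. *)
Definition area : set (R3 R) -> \bar R :=
  pushforward (@lebesgue_measure R \x @lebesgue_measure R)%E chart.

Let area0 : area set0 = 0%E.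
Proof. by rewrite /area /pushforward preimage_set0 measure0. Qed.

Let area_ge0 A : (0 <= area A)%E.
Proof. exact: measure_ge0. Qed.

Let area_sigma_additive : semi_sigma_additive area.
Proof.
exact: (@measure_semi_sigma_additive _ _ _
  (pushforward (@lebesgue_measure R \x @lebesgue_measure R)%E
     (chart : {mfun R2 R >-> R3 R}))).
Qed.

HB.instance Definition _ := isMeasure.Build _ _ _ area
  area0 area_ge0 area_sigma_additive.

End Geometry.

Definition latticeH : set Z3 := [set j | j.1.1 + j.1.2 + j.2 = 0].

Section IndexSets.
Variable n : nat.

Definition indexH : set Z3 :=
  [set j | latticeH j /\
    [/\ - n%:Z <= j.1.1 < n%:Z, - n%:Z <= j.1.2 < n%:Z
      & - n%:Z <= - j.2 < n%:Z]].

Definition indexH_star : set Z3 :=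
  [set j | latticeH j /\
    [/\ - n%:Z <= j.1.1 <= n%:Z, - n%:Z <= j.1.2 <= n%:Z
      & - n%:Z <= j.2 <= n%:Z]].

Definition indexH_open : set Z3 :=
  [set j | latticeH j /\
    [/\ - n%:Z < j.1.1 < n%:Z, - n%:Z < j.1.2 < n%:Z
      & - n%:Z < j.2 < n%:Z]].

(** The sums [\sum_(j \in A)] below range over these sets; by convention such a
    sum is 0 when its support is infinite, which never happens here. *)
Lemma finite_indexH_star : finite_set indexH_star.
Proof.
pose c (i : 'I_n.*2.+1) : int := i%:Z - n%:Z.
have cP (z : int) : - n%:Z <= z <= n%:Z -> range c z.
  move=> /andP[h1 h2]; have z0 : 0 <= z + n%:Z by lia.
  have zn : (`|(z + n%:Z)%R|%N < n.*2.+1)%N by lia.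
  by exists (Ordinal zn) => //; rewrite /c /= gez0_abs//; lia.
have fc : finite_set (range c) by exact: finite_image.
apply: (@sub_finite_set _ _ (range c `*` range c `*` range c)).
  by move=> [[a b] d] /= [_ [/= /cP ? /cP ? /cP ?]].
by do 2?apply: finite_setX.
Qed.

Lemma finite_indexH : finite_set indexH.
Proof.
apply: sub_finite_set finite_indexH_star => -[[a b] c].
by move=> /= [h [/= ? ? ?]]; split=> //=; split; lia.
Qed.

End IndexSets.

Section TrigPolynomials.
Variable R : realType.

Definition cexp (z : R[i]) : R[i] :=
  (expR (complex.Re z))%:C * (cos (complex.Im z) +i* sin (complex.Im z)).

Definition dotH (j : Z3) (t : R3 R) : R :=
  j.1.1%:~R * t.1.1 + j.1.2%:~R * t.1.2 + j.2%:~R * t.2.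

Definition phi (j : Z3) (t : R3 R) : R[i] :=
  cexp ((2 * pi)%:C * 'i / 3 * (dotH j t)%:C).

(** The complex span, among functions on the plane, of the [phi j] with [j] in
    [indexH n]. *)
Definition trigH (n : nat) : set (R3 R -> R[i]) :=
  [set f | exists a : Z3 -> R[i], forall t, planeH t ->
    f t = \sum_(j \in indexH n) a j * phi j t].

(** The integral of a complex-valued function is taken componentwise. *)
Definition Cintegral (D : set (R3 R)) (h : R3 R -> R[i]) : R[i] :=
  Rintegral (@area R) D (fun t => complex.Re (h t))
  +i* Rintegral (@area R) D (fun t => complex.Im (h t)).

Definition node (n : nat) (j : Z3) : R3 R :=
  (j.1.1%:~R / n%:R, j.1.2%:~R / n%:R, j.2%:~R / n%:R).

(** Only meaningful for [j] in [indexH_star n]. *)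
Definition weight (n : nat) (j : Z3) : R[i] :=
  if j \in indexH_open n then 1
  else if j.1.1 * j.1.2 * j.2 != 0 then 1 / 2 else 1 / 3.

Definition innerH (f g : R3 R -> R[i]) : R[i] :=
  ((fine (area (@Omega R)))^-1)%:C * Cintegral (@Omega R) (fun t => f t * (g t)^*).

Definition innern (n : nat) (f g : R3 R -> R[i]) : R[i] :=
  1 / (3 * n%:R ^+ 2) *
  \sum_(j \in indexH n) f (node n j) * (g (node n j))^*.

Definition innern_star (n : nat) (f g : R3 R -> R[i]) : R[i] :=
  1 / (3 * n%:R ^+ 2) *
  \sum_(j \in indexH_star n) weight n j * f (node n j) * (g (node n j))^*.

End TrigPolynomials.

(* Main.v *)
Require Import Defs.
From HB Require Import structures.
From mathcomp Require Import all_boot all_order all_algebra.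
From mathcomp Require Import all_classical all_reals all_analysis.
From mathcomp Require Import complex.
From mathcomp Require Import measurable_realfun zify ring lra.

(** The product of f and the conjugate of g is a combination of characters
    phi_(j - k) with j and k in [indexH n], so the first equality says that the
    continuous mean over the hexagon and the discrete mean over its nodes give
    the same value to every such character, namely 1 if j = k and 0 otherwise
    ([mean_phi], [discrete_mean_phi]).

    The vanishing of both means has a single cause.  All characters with
    frequency in [latticeH] are periodic under the lattice generated by
    (2, -1, -1), (-1, 2, -1) and (1, 1, -2), and the hexagon tiles the plane
    under this lattice.  Consider any additive set function J which turns a
    translation by v into multiplication by phi_m(v).  When the hexagon is moved
    by s = (sigma, 0, -sigma) with 0 <= sigma <= 1, what it gains differs from
    what it loses by translating two pieces along periods, so J takes the same
    value on the hexagon and on its translate: (phi_m(s) - 1) J(Omega) = 0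
    ([equivariant_Omega_x]); the same holds for s = (0, sigma, -sigma)
    ([equivariant_Omega_y]).  For J(D) the integral of phi_m over D, every s of
    this form is allowed, and some s has phi_m(s) <> 1 as soon as m <> 0.  For
    J(D) the sum of phi_m over the nodes in D, the translation s must join two
    nodes, and sigma = 1/n shows that J(Omega) = 0 unless m is n times a period;
    among the differences of two elements of [indexH n] only m = 0 is.

    Two numbers remain: the area of the hexagon is positive and finite, because
    the hexagon contains a rectangle and lies in another one, and [indexH n] has
    3 n^2 elements, because it can be cut and reassembled into three squares.

    For the second equality only periodicity matters.  The closed hexagon is
    covered by [indexH n] and its translates by the three periods; the weights
    are such that those of all points equivalent to a given element of
    [indexH n] add up to 1 ([weight0_sum]). *)

Set Implicit Arguments.
Unset Strict Implicit.
Unset Printing Implicit Defensive.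

Import Order.TTheory GRing.Theory Num.Theory.

Local Open Scope classical_set_scope.
Local Open Scope ring_scope.
Local Open Scope complex_scope.

(** * Characters of the plane *)

Section Characters.
Variable R : realType.
Implicit Types (x y : R) (t u v : R3 R) (j k m : Z3).

Definition cis x : R[i] := cos x +i* sin x.

Lemma cisD x y : cis (x + y) = cis x * cis y.
Proof.
by apply/eqP; rewrite eq_complex /= cosD sinD eqxx addrC eqxx.
Qed.

Lemma cis0 : cis 0 = 1.
Proof. by rewrite /cis cos0 sin0. Qed.

Lemma conj_cis x : Num.conj (cis x) = cis (- x).
Proof.
have -> : Num.conj (cis x) = (cis x)^* by [].
by apply/eqP; rewrite eq_complex /= cosN sinN !eqxx.
Qed.

Lemma cis2pi_nat (n : nat) : cis (2 * pi * n%:R) = 1.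
Proof.
elim: n => [|n IH]; first by rewrite mulr0 cis0.
rewrite -[n.+1%:R]natr1 mulrDr cisD IH mul1r mulr1.
by rewrite /cis mulr_natl cos2pi sin2pi.
Qed.

Lemma cis2pi_int (z : int) : cis (2 * pi * z%:~R) = 1.
Proof.
case: z => n; first exact: cis2pi_nat.
by rewrite NegzE mulrNz mulrN -conj_cis cis2pi_nat rmorph1.
Qed.

(** By cos x = 1 - 2 sin(x/2)^2, where sin(x/2) > 0. *)
Lemma cis_neq1 x : 0 < x < 2 * pi -> cis x != 1.
Proof.
move=> /andP[x0 x1]; apply/eqP => -[c1 _].
have s0 : 0 < sin (x / 2) by apply: sin_gt0_pi; apply/andP; split; lra.
have := cos_mulr2n (x / 2); rewrite cos2sin2 mulr2n -splitr c1 => h.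
have : 0 < sin (x / 2) ^+ 2 by rewrite exprn_gt0.
by move: h; rewrite mulr2n; lra.
Qed.

Lemma phiE j t : phi j t = cis (2 * pi / 3 * dotH j t).
Proof.
rewrite /phi /cexp.
have -> : ((2 * pi)%:C * 'i / 3 * (dotH j t)%:C : R[i])
    = 0 +i* (2 * pi / 3 * dotH j t).
  have -> : (3 : R[i])^-1 = (3^-1 : R)%:C.
    by rewrite -[3 in LHS](rmorph_nat (real_complex R)) -fmorphV.
  by apply/eqP; rewrite eq_complex /=; apply/andP; split; apply/eqP; ring.
by rewrite /= expR0 mul1r.
Qed.

Definition addH t v : R3 R := (t.1.1 + v.1.1, t.1.2 + v.1.2, t.2 + v.2).

Lemma phiD m t v : phi m (addH t v) = phi m t * phi m v.
Proof. by rewrite !phiE -cisD -mulrDr /dotH /addH /=; congr (cis (_ * _)); ring. Qed.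

Definition subZ3 j k : Z3 := (j.1.1 - k.1.1, j.1.2 - k.1.2, j.2 - k.2).

Lemma phi_mul_conj j k t : phi j t * Num.conj (phi k t) = phi (subZ3 j k) t.
Proof.
rewrite !phiE conj_cis -cisD -mulrN -mulrDr; congr (cis (_ * _)).
by rewrite /dotH /subZ3 /= !intrB; ring.
Qed.

Lemma phi0 t : phi (0, 0, 0) t = 1.
Proof. by rewrite phiE /dotH /= !mul0r !addr0 mulr0 cis0. Qed.

(** The common form of the three periods below: the scalar product with a
    frequency of sum 0 is a multiple of 3, which the factor 1/3 in the exponent
    turns into a multiple of 2 pi. *)
Lemma phi_dot3 m t (z : int) : dotH m t = 3 * z%:~R -> phi m t = 1.
Proof.
by move=> h; rewrite phiE h -[RHS](cis2pi_int z); congr cis; field.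
Qed.

Lemma phi_period3 m : latticeH m -> phi m ((1, 1, -2) : R3 R) = 1.
Proof.
move=> mH; apply: (@phi_dot3 _ _ (- m.2)); rewrite /dotH /=.
have -> : m.1.1 = - m.1.2 - m.2 by move: mH; rewrite /latticeH /=; lia.
by rewrite !intrD !intrN; ring.
Qed.

Lemma phi_period1 m : latticeH m -> phi m ((2, -1, -1) : R3 R) = 1.
Proof.
move=> mH; apply: (@phi_dot3 _ _ m.1.1); rewrite /dotH /=.
have -> : m.2 = - m.1.2 - m.1.1 by move: mH; rewrite /latticeH /=; lia.
by rewrite !intrD !intrN; ring.
Qed.

Lemma phi_period2 m : latticeH m -> phi m ((-1, 2, -1) : R3 R) = 1.
Proof.
move=> mH; apply: (@phi_dot3 _ _ m.1.2); rewrite /dotH /=.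
have -> : m.2 = - m.1.2 - m.1.1 by move: mH; rewrite /latticeH /=; lia.
by rewrite !intrD !intrN; ring.
Qed.

End Characters.

(** * Additive set functions on the hexagon that transform by a character *)

Section Geometry.
Variable R : realType.
Implicit Types (D E : set (R3 R)) (t v : R3 R).

Definition oppH v : R3 R := (- v.1.1, - v.1.2, - v.2).

Lemma addH_opp t v : addH (addH t v) (oppH v) = t.
Proof. by case: t => -[x y] z; rewrite /addH /oppH /= !addrK. Qed.

Definition translate v D : set (R3 R) := [set t | D (addH t (oppH v))].

(** The sets on which the set functions below are required to be additive: the
    bound, large enough for the hexagon and all its translates that occur, makes
    their area finite and lets them contain finitely many nodes. *)
Definition admissible D :=
  [/\ measurable D, D `<=` @planeH R &
      forall t, D t -> (`|t.1.1| <= 3) && (`|t.1.2| <= 3)].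

Lemma measurable_x : measurable_fun setT (fun t : R3 R => t.1.1 : R).
Proof. exact: (measurableT_comp measurable_fst measurable_fst). Qed.

Lemma measurable_y : measurable_fun setT (fun t : R3 R => t.1.2 : R).
Proof. exact: (measurableT_comp measurable_snd measurable_fst). Qed.

Lemma measurable_z : measurable_fun setT (fun t : R3 R => t.2 : R).
Proof. exact: measurable_snd. Qed.

Lemma measurable_addH v : measurable_fun setT (fun t : R3 R => addH t v).
Proof.
apply: measurable_fun_pair; first apply: measurable_fun_pair.
- by apply: measurable_funD => //; exact: measurable_x.
- by apply: measurable_funD => //; exact: measurable_y.
- by apply: measurable_funD => //; exact: measurable_z.
Qed.

Lemma measurable_translate v D : measurable D -> measurable (translate v D).
Proof.
by move=> mD; rewrite -[translate v D]setTI; exact: measurable_addH.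
Qed.

Lemma measurable_pred (p : R3 R -> bool) :
  measurable_fun setT p -> measurable [set t | p t].
Proof.
move=> mp; rewrite (_ : [set t | p t] = setT `&` p @^-1` [set true]).
  exact: mp.
by rewrite setTI.
Qed.

Lemma measurable_xy : measurable_fun setT (fun t : R3 R => t.1.1 + t.1.2 : R).
Proof. by apply: measurable_funD; [exact: measurable_x|exact: measurable_y]. Qed.

Lemma measurable_slab (f g : R3 R -> R) (a b : R) :
  measurable_fun setT f -> measurable_fun setT g ->
  measurable [set t | (a <= f t) && (g t < b)].
Proof.
move=> mf mg; apply: measurable_pred; apply: measurable_and.
- exact: measurable_fun_ler.
- exact: measurable_fun_ltr.
Qed.

Lemma measurable_planeH : measurable (@planeH R).
Proof.
rewrite (_ : @planeH R = [set t : R3 R | t.1.1 + t.1.2 + t.2 == 0 :> R]).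
  apply: measurable_pred; apply: measurable_fun_eqr => //.
  by apply: measurable_funD; [exact: measurable_xy|exact: measurable_z].
by apply/seteqP; split => t /= /eqP.
Qed.

(** A form of the definition of the hexagon suited to linear arithmetic. *)
Lemma OmegaE t : @Omega R t = (t.1.1 + t.1.2 + t.2 = 0 /\
  [&& -1 <= t.1.1, t.1.1 < 1, -1 <= t.1.2, t.1.2 < 1, -1 <= - t.2 & - t.2 < 1]).
Proof.
apply/propext; split=> [[h [/andP[-> ->] /andP[-> ->] /andP[-> ->]]]|[h]] //.
by move=> /and5P[? ? ? ? /andP[? ?]]; split=> //; split; apply/andP.
Qed.

Lemma measurable_Omega : measurable (@Omega R).
Proof.
rewrite (_ : @Omega R = @planeH R `&`
   ([set t : R3 R | -1 <= t.1.1 < 1] `&`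
   ([set t : R3 R | -1 <= t.1.2 < 1] `&` [set t : R3 R | -1 <= - t.2 < 1]))).
  apply: measurableI; first exact: measurable_planeH.
  apply: measurableI; first exact: measurable_slab measurable_x measurable_x.
  apply: measurableI; first exact: measurable_slab measurable_y measurable_y.
  apply: measurable_slab; apply: measurableT_comp => //; exact: measurable_z.
by apply/seteqP; split => t /=; [case=> ? []|case=> ? [? []]].
Qed.

Lemma admissible_sub_Omega D :
  measurable D -> D `<=` @Omega R -> admissible D.
Proof.
move=> mD DO; split=> // t /DO[] // _ [] /andP[? ?] /andP[? ?] _.
by rewrite !ler_norml; lra.
Qed.

Lemma admissible_translate v D : planeH v -> `|v.1.1| <= 2 -> `|v.1.2| <= 2 ->
  measurable D -> D `<=` @Omega R -> admissible (translate v D).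
Proof.
rewrite /planeH /= => vH; rewrite !ler_norml => /andP[? ?] /andP[? ?] mD DO.
split; first exact: measurable_translate.
  by move=> t /DO[]; rewrite /planeH/= => ? _; lra.
move=> t /DO[] /= _ [] /andP[? ?] /andP[? ?] _.
by rewrite !ler_norml; lra.
Qed.

Section Equivariant.
Variables (J : set (R3 R) -> R[i]) (V : set (R3 R)) (m : Z3).
Hypothesis mH : latticeH m.
Hypothesis JU : forall D E, admissible D -> admissible E -> D `&` E `<=` set0 ->
  J (D `|` E) = J D + J E.
Hypothesis JV : forall v D, V v -> admissible D -> admissible (translate v D) ->
  J (translate v D) = phi m v * J D.

(** The set W is the overlap of the hexagon and its translate by s, and A, B are
    the two pieces that leave.  When they come back translated by v and w, which
    multiplies J by phi_m(v) = phi_m(w) = 1, the two unions have the same J. *)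
Lemma equivariant_cut s v w A B :
    [/\ V s, V v & V w] -> [/\ planeH s, planeH v & planeH w] ->
    [/\ (`|s.1.1| <= 2) && (`|s.1.2| <= 2), (`|v.1.1| <= 2) && (`|v.1.2| <= 2)
      & (`|w.1.1| <= 2) && (`|w.1.2| <= 2)] ->
    phi m v = 1 -> phi m w = 1 -> measurable A -> measurable B ->
    let W := @Omega R `&` translate s (@Omega R) in
    A `<=` @Omega R -> B `<=` @Omega R -> A `&` B `<=` set0 ->
    W `&` (A `|` B) `<=` set0 ->
    translate v A `&` translate w B `<=` set0 ->
    W `&` (translate v A `|` translate w B) `<=` set0 ->
    @Omega R = W `|` (A `|` B) ->
    translate s (@Omega R) = W `|` (translate v A `|` translate w B) ->
  phi m s * J (@Omega R) = J (@Omega R).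
Proof.
move=> [Vs Vv Vw] [Hs Hv Hw] [/andP[s1 s2] /andP[v1 v2] /andP[w1 w2]] pv pw mA mB W.
move=> AO BO AB WAB AB' WAB' OE OE'.
have mO := measurable_Omega.
have mW : measurable W by apply: measurableI => //; exact: measurable_translate.
have aA : admissible A by exact: admissible_sub_Omega.
have aB : admissible B by exact: admissible_sub_Omega.
have aW : admissible W by apply: admissible_sub_Omega => // t [].
have aAB : admissible (A `|` B).
  by apply: admissible_sub_Omega; [exact: measurableU|move=> t [/AO|/BO]].
have aA' : admissible (translate v A) by exact: admissible_translate.
have aB' : admissible (translate w B) by exact: admissible_translate.
have aAB' : admissible (translate v A `|` translate w B).
  case: aA' aB' => [? h1 h2] [? h3 h4]; split; first exact: measurableU.
    by move=> t [/h1|/h3].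
  by move=> t [/h2|/h4].
rewrite -JV //; [|exact: admissible_sub_Omega|exact: admissible_translate].
rewrite [in LHS]OE' [in RHS]OE !JU //.
by rewrite !JV // pv pw !mul1r.
Qed.

(** On the line of constant second coordinate y, the hexagon is a half-open
    segment of length at least 1.  It starts on the edge x + y = -1 if y < 0 and
    on the edge x = -1 if y >= 0.  The part of length s lost at that end is the
    piece A in the first case, B in the second; the part gained at the other end
    is the translate of B by (2, -1, -1) if y < 0 and that of A by (1, 1, -2) if
    y >= 0. *)
Lemma equivariant_Omega_x (s : R) : 0 <= s <= 1 ->
  V (s, 0, - s) -> V (1, 1, -2) -> V (2, -1, -1) ->
  phi m ((s, 0, - s) : R3 R) * J (@Omega R) = J (@Omega R).
Proof.
move=> /andP[s0 s1] Vs V1 V2.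
pose A := @Omega R `&` [set t | (t.1.2 < 0) && (t.1.1 + t.1.2 < -1 + s)].
pose B := @Omega R `&` [set t | (0 <= t.1.2) && (t.1.1 < -1 + s)].
apply: (@equivariant_cut _ (1, 1, -2) (2, -1, -1) A B).
- by [].
- by split; rewrite /planeH /=; lra.
- by rewrite !ler_norml /=; split; apply/andP; lra.
- exact: phi_period3.
- exact: phi_period1.
- apply: measurableI; first exact: measurable_Omega.
  by apply: measurable_pred; apply: measurable_and; apply: measurable_fun_ltr => //;
    [exact: measurable_y|exact: measurable_xy].
- apply: measurableI; first exact: measurable_Omega.
  exact: measurable_slab measurable_y measurable_x.
- by move=> t [].
- by move=> t [].
- by move=> t; rewrite /A /B /setI /= !OmegaE /=; lra.
- by move=> t [Wt [At|Bt]]; move: Wt; [move: At|move: Bt];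
    rewrite /A /B /translate /setI /= !OmegaE /=; lra.
- by move=> t; rewrite /A /B /translate /setI /= !OmegaE /=; lra.
- by move=> t [Wt [At|Bt]]; move: Wt; [move: At|move: Bt];
    rewrite /A /B /translate /setI /= !OmegaE /=; lra.
- apply/seteqP; split=> t; last by case=> [[]|[[]|[]]].
  rewrite /A /B /translate /setI /= !OmegaE /=; case: t => -[x y] z /=.
  move=> [h /and5P[x1 x2 y1 y2 /andP[z1 z2]]].
  have [y0|y0] := ltP y 0.
    have [c|c] := ltP (x + y) (-1 + s); [by right; left; split; lra|left].
    by split; lra.
  have [c|c] := ltP x (-1 + s); [by right; right; split; lra|left].
  by split; lra.
- apply/seteqP; split=> t; last first.
    by case=> [[_ //]|[]]; rewrite /A /B /translate /setI /= !OmegaE /=; lra.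
  rewrite /A /B /translate /setI /= !OmegaE /=; case: t => -[x y] z /=.
  move=> [h /and5P[x1 x2 y1 y2 /andP[z1 z2]]].
  have [y0|y0] := ltP y 0.
    have [c|c] := leP 1 x; [right; right|left].
      by split; lra.
    by split; lra.
  have [c|c] := leP 1 (x + y); [right; left|left].
    by split; lra.
  by split; lra.
Qed.

(** The same argument with the first two coordinates exchanged. *)
Lemma equivariant_Omega_y (s : R) : 0 <= s <= 1 ->
  V (0, s, - s) -> V (1, 1, -2) -> V (-1, 2, -1) ->
  phi m ((0, s, - s) : R3 R) * J (@Omega R) = J (@Omega R).
Proof.
move=> /andP[s0 s1] Vs V1 V2.
pose A := @Omega R `&` [set t | (t.1.1 < 0) && (t.1.1 + t.1.2 < -1 + s)].
pose B := @Omega R `&` [set t | (0 <= t.1.1) && (t.1.2 < -1 + s)].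
apply: (@equivariant_cut _ (1, 1, -2) (-1, 2, -1) A B).
- by [].
- by split; rewrite /planeH /=; lra.
- by rewrite !ler_norml /=; split; apply/andP; lra.
- exact: phi_period3.
- exact: phi_period2.
- apply: measurableI; first exact: measurable_Omega.
  by apply: measurable_pred; apply: measurable_and; apply: measurable_fun_ltr => //;
    [exact: measurable_x|exact: measurable_xy].
- apply: measurableI; first exact: measurable_Omega.
  exact: measurable_slab measurable_x measurable_y.
- by move=> t [].
- by move=> t [].
- by move=> t; rewrite /A /B /setI /= !OmegaE /=; lra.
- by move=> t [Wt [At|Bt]]; move: Wt; [move: At|move: Bt];
    rewrite /A /B /translate /setI /= !OmegaE /=; lra.
- by move=> t; rewrite /A /B /translate /setI /= !OmegaE /=; lra.
- by move=> t [Wt [At|Bt]]; move: Wt; [move: At|move: Bt];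
    rewrite /A /B /translate /setI /= !OmegaE /=; lra.
- apply/seteqP; split=> t; last by case=> [[]|[[]|[]]].
  rewrite /A /B /translate /setI /= !OmegaE /=; case: t => -[x y] z /=.
  move=> [h /and5P[x1 x2 y1 y2 /andP[z1 z2]]].
  have [y0|y0] := ltP x 0.
    have [c|c] := ltP (x + y) (-1 + s); [by right; left; split; lra|left].
    by split; lra.
  have [c|c] := ltP y (-1 + s); [by right; right; split; lra|left].
  by split; lra.
- apply/seteqP; split=> t; last first.
    by case=> [[_ //]|[]]; rewrite /A /B /translate /setI /= !OmegaE /=; lra.
  rewrite /A /B /translate /setI /= !OmegaE /=; case: t => -[x y] z /=.
  move=> [h /and5P[x1 x2 y1 y2 /andP[z1 z2]]].
  have [y0|y0] := ltP x 0.
    have [c|c] := leP 1 y; [right; right|left].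
      by split; lra.
    by split; lra.
  have [c|c] := leP 1 (x + y); [right; left|left].
    by split; lra.
  by split; lra.
Qed.

End Equivariant.
End Geometry.

(** * Sums of characters over the nodes *)

Section Discrete.
Variable R : realType.
Implicit Types (m j k : Z3) (n : nat).

Lemma cis_root_unity (p : int) (N : nat) : (0 < N)%N ->
  cis (2 * pi * (p%:~R / N%:R) : R) = 1 -> exists q : int, p = q * N%:Z.
Proof.
move=> N0 h; exists (p %/ N%:Z)%Z.
have Nr : 0 < N%:R :> R by rewrite ltr0n.
have pE := divz_eq p N%:Z; set q := (p %/ N%:Z)%Z in pE *.
set r := (p %% N%:Z)%Z in pE.
have r0 : 0 <= r by apply: modz_ge0; lia.
have rN : r < N%:Z by apply: ltz_pmod; lia.
have [r00|rn0] := eqVneq r 0; first by rewrite pE r00 addr0.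
clearbody r; clearbody q.
suff /negP[] : cis (2 * pi * (r%:~R / N%:R) : R) != 1.
  apply/eqP; rewrite -[RHS]h pE intrD intrM.
  have -> : 2 * pi * ((q%:~R * N%:Z%:~R + r%:~R) / N%:R)
      = 2 * pi * q%:~R + 2 * pi * (r%:~R / N%:R) :> R by field; rewrite gt_eqF.
  by rewrite cisD cis2pi_int mul1r.
have rr : 0 < r%:~R :> R by rewrite ltr0z; lia.
have rr' : r%:~R < N%:R :> R.
  by rewrite -[N%:R]/((N%:Z)%:~R) ltr_int.
apply: cis_neq1; apply/andP; split.
  by rewrite !mulr_gt0// ?pi_gt0// invr_gt0.
by rewrite gtr_pMr ?mulr_gt0 ?pi_gt0// ltr_pdivrMr// mul1r.
Qed.

Lemma indexHE n j : indexH n j =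
  (j.1.1 + j.1.2 + j.2 = 0 /\ [&& - n%:Z <= j.1.1, j.1.1 < n%:Z,
     - n%:Z <= j.1.2, j.1.2 < n%:Z, - n%:Z <= - j.2 & - j.2 < n%:Z]).
Proof.
apply/propext; split=> [[h [/andP[-> ->] /andP[-> ->] /andP[-> ->]]]|[h]] //.
by move=> /and5P[? ? ? ? /andP[? ?]]; split=> //; split; apply/andP.
Qed.

(** Three n by n squares tile the half-open hexagon after a translation of half
    of the third one: the hexagon consists of the two squares adjacent to the
    square [0, n)^2 on its left and below, of the part x + y < n of that square,
    and of the translate of its other part by (-n, -n). *)
Definition cell n (x : 'I_n * 'I_n * 'I_3) : Z3 :=
  let a := x.1.1%:Z in let b := x.1.2%:Z in
  let p := if x.2 == 0%N :> nat then (a - n%:Z, b) else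
           if x.2 == 1%N :> nat then (a, b - n%:Z) else
           if a + b < n%:Z then (a, b) else (a - n%:Z, b - n%:Z) in
  (p.1, p.2, - (p.1 + p.2)).

Lemma cell_bij n : set_bij [set: 'I_n * 'I_n * 'I_3] (indexH n) (@cell n).
Proof.
split.
- move=> [[[a an] [b bn]] [c c3]] _; rewrite indexHE /cell /=.
  by case: c c3 => [|[|c]] c3 /=; [|..|case: ifP => ? /=]; lia.
- move=> [[[a an] [b bn]] [c c3]] [[[a' an'] [b' bn']] [c' c3']] _ _.
  rewrite /cell /= => h.
  suff [ea eb ec] : [/\ a = a', b = b' & c = c'] by congr (_, _, _); exact: val_inj.
  move: c c3 c' c3' h => [|[|[|//]]] c3 [|[|[|//]]] c3' /=; do ?case: ifP => /= ?;
  by move=> [? ? ?]; split; lia.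
- move=> [[x y] z]; rewrite indexHE /= => -[h1 h2].
  have key (a b c : nat) : (a < n)%N -> (b < n)%N -> (c < 3)%N ->
     (forall (ha : (a < n)%N) (hb : (b < n)%N) (hc : (c < 3)%N),
       cell (Ordinal ha, Ordinal hb, Ordinal hc) = (x, y, z)) ->
     exists u, @cell n u = (x, y, z).
    by move=> ha hb hc hE; exists (Ordinal ha, Ordinal hb, Ordinal hc); exact: hE.
  suff [u hu] : exists u, @cell n u = (x, y, z) by exists u.
  have [x0|x0] := ltP x 0; have [y0|y0] := ltP y 0.
  + by apply: (key (absz (x + n%:Z)) (absz (y + n%:Z)) 2%N); [lia..|];
    move=> ? ? ?; rewrite /cell /=; case: ifP => ? /=; congr (_, _, _); lia.
  + by apply: (key (absz (x + n%:Z)) (absz y) 0%N); [lia..|];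
    move=> ? ? ?; rewrite /cell /=; congr (_, _, _); lia.
  + by apply: (key (absz x) (absz (y + n%:Z)) 1%N); [lia..|];
    move=> ? ? ?; rewrite /cell /=; congr (_, _, _); lia.
  + by apply: (key (absz x) (absz y) 2%N); [lia..|];
    move=> ? ? ?; rewrite /cell /=; case: ifP => ? /=; congr (_, _, _); lia.
Qed.

Lemma card_indexH n : \sum_(j \in indexH n) (1 : R[i]) = 3 * n%:R ^+ 2.
Proof.
rewrite (reindex_fsbig (@cell n) setT); last exact: cell_bij.
have -> : [set: 'I_n * 'I_n * 'I_3] = [set` enum {: 'I_n * 'I_n * 'I_3}].
  by apply/seteqP; split=> x //= _; rewrite mem_enum.
rewrite -fsbig_seq ?enum_uniq// big_enum /= sumr_const !card_prod !card_ord.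
by rewrite mulnC !natrM expr2.
Qed.

Definition node_sum n m (D : set (R3 R)) : R[i] :=
  \sum_(j \in [set j | latticeH j /\ D (node R n j)]) phi m (node R n j).

Lemma nodeH n j : latticeH j -> planeH (node R n j).
Proof.
rewrite /latticeH /planeH /node /= => h.
by rewrite -!mulrDl -!intrD h mul0r.
Qed.

Lemma finite_nodes n D : (1 <= n)%N -> @admissible R D ->
  finite_set [set j | latticeH j /\ D (node R n j)].
Proof.
move=> n1 [_ _ Db]; apply: sub_finite_set (finite_indexH_star (6 * n)).
have nr : 0 < n%:R :> R by rewrite ltr0n.
have key (x : int) : `|x%:~R / n%:R : R| <= 3 -> `|x| <= (3 * n)%:Z.
  rewrite normrM [`|_^-1|]gtr0_norm ?invr_gt0// ler_pdivrMr//.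
  rewrite -intr_norm => h; rewrite -(ler_int R) PoszM intrM; exact: h.
by move=> j [jH /Db /= /andP[/key h1 /key h2]]; move: jH h1 h2;
  rewrite /latticeH /indexH_star /= => jH h1 h2; split=> //; split; lia.
Qed.

Definition addZ3 j k : Z3 := (j.1.1 + k.1.1, j.1.2 + k.1.2, j.2 + k.2).

Lemma node_add n j k : node R n (addZ3 j k) = addH (node R n j) (node R n k).
Proof. by rewrite /node /addH /addZ3 /= !intrD !mulrDl. Qed.

Lemma node_sum_translate n m k D : latticeH k ->
  (1 <= n)%N -> admissible D ->
  node_sum n m (translate (node R n k) D) = phi m (node R n k) * node_sum n m D.
Proof.
move=> kH n1 aD; rewrite /node_sum.
rewrite (reindex_fsbig (fun j => addZ3 j k) [set j | latticeH j /\ D (node R n j)]).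
  rewrite fsbig_distrr; last exact: finite_nodes.
  by apply: eq_fsbigr => j _; rewrite node_add phiD mulrC.
split.
- move=> j /= [jH Dj]; rewrite /translate /= node_add addH_opp; split=> //.
  by move: jH kH; rewrite /latticeH /=; lia.
- move=> [[a b] c] [[a' b'] c'] _ _ [? ? ?]; congr (_, _, _); lia.
- move=> j [jH Dj]; have jE : j = addZ3 (subZ3 j k) k.
    by case: j {jH Dj} => -[a b] c; rewrite /addZ3 /subZ3 /=; congr (_, _, _); lia.
  exists (subZ3 j k) => //=; split.
    by move: jH kH; rewrite /latticeH /=; lia.
  by move: Dj; rewrite [in X in X -> _]jE /translate /= node_add addH_opp.
Qed.

(** The half-open conventions of [Omega] and [indexH] agree, so the sum over
    [indexH n] is the value on the hexagon of the set function [node_sum]. *)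
Lemma node_Omega n j : (1 <= n)%N -> latticeH j ->
  Omega (node R n j) = indexH n j.
Proof.
move=> n1 jH; have nr : 0 < n%:R :> R by rewrite ltr0n.
have [jH' nH] := (jH, nodeH n jH).
rewrite OmegaE indexHE; move: jH' nH; rewrite /latticeH /planeH /= => -> ->.
rewrite -!mulNr !ler_pdivlMr// !ltr_pdivrMr// mulN1r mul1r.
rewrite -[n%:R]/((n%:Z)%:~R) -!intrN !ler_int !ltr_int.
by apply/propext; split=> -[_ ->].
Qed.

Lemma node_sum_Omega n m : (1 <= n)%N ->
  node_sum n m (@Omega R) = \sum_(j \in indexH n) phi m (node R n j).
Proof.
move=> n1; apply: eq_fsbigl; apply/seteqP; split=> j /=.
  by move=> [jH]; rewrite node_Omega.
by move=> hj; have jH : latticeH j by [case: hj]; split; rewrite ?node_Omega.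
Qed.

Lemma node_sumU n m D E : (1 <= n)%N -> admissible D -> admissible E ->
  D `&` E `<=` set0 ->
  node_sum n m (D `|` E) = node_sum n m D + node_sum n m E.
Proof.
move=> n1 aD aE DE; rewrite /node_sum -fsbigU0.
- apply: eq_fsbigl; apply/seteqP; split=> j /=; first by case=> ? [?|?]; [left|right].
  by case=> -[? ?]; split=> //; [left|right].
- exact: finite_nodes.
- exact: finite_nodes.
- by move=> j [[_ ?] [_ ?]]; apply: DE; split; eassumption.
Qed.

(** If the sum does not vanish, then phi_m is 1 at the nodes (1/n, 0, -1/n) and
    (0, 1/n, -1/n), whose scalar products with m are (m1 - m3)/n and
    (m2 - m3)/n. *)
Lemma sum_phi_neq0 n m : (1 <= n)%N -> latticeH m ->
  \sum_(i \in indexH n) phi m (node R n i) != 0 ->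
  exists p q : int, m.1.1 - m.2 = p * (3 * n)%N%:Z /\ m.1.2 - m.2 = q * (3 * n)%N%:Z.
Proof.
move=> n1 mH; rewrite -node_sum_Omega// => J0.
have nr : 0 < n%:R :> R by rewrite ltr0n.
have n0 : n%:R != 0 :> R by rewrite gt_eqF.
have s01 : 0 <= (n%:R^-1 : R) <= 1.
  by rewrite invr_ge0 ltW//= invf_le1// ler1n.
pose V := [set v : R3 R | exists2 k, latticeH k & v = node R n k].
have JU D E : admissible D -> admissible E -> D `&` E `<=` set0 ->
  node_sum n m (D `|` E) = node_sum n m D + node_sum n m E.
  exact: node_sumU.
have JV v D : V v -> admissible D -> admissible (translate v D) ->
    node_sum n m (translate v D) = phi m v * node_sum n m D.
  by move=> [k kH ->] aD _; exact: node_sum_translate.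
have V1 : V (1, 1, -2).
  exists (n%:Z, n%:Z, - (2 * n%:Z)); first by rewrite /latticeH /=; lia.
  by rewrite /node /= !intrN !intrM; congr (_, _, _); field.
have V2 : V (2, -1, -1).
  exists (2 * n%:Z, - n%:Z, - n%:Z); first by rewrite /latticeH /=; lia.
  by rewrite /node /= !intrN !intrM; congr (_, _, _); field.
have V3 : V (-1, 2, -1).
  exists (- n%:Z, 2 * n%:Z, - n%:Z); first by rewrite /latticeH /=; lia.
  by rewrite /node /= !intrN !intrM; congr (_, _, _); field.
have root (p : int) (v : R3 R) : phi m v * node_sum n m (@Omega R) = node_sum n m (@Omega R) ->
    dotH m v = p%:~R / n%:R -> exists q : int, p = q * (3 * n)%N%:Z.
  move=> h dv; apply: cis_root_unity; first by rewrite muln_gt0.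
  have <- : phi m v = 1 by apply: (mulIf J0); rewrite h mul1r.
  by rewrite phiE dv natrM; congr cis; field.
have [||p hp] := root (m.1.1 - m.2) (n%:R^-1, 0, - n%:R^-1).
- apply: (equivariant_Omega_x mH JU JV) => //.
  by exists (1, 0, -1); rewrite // /node /= mul0r mul1r mulN1r.
- by rewrite /dotH /= intrD intrN; field.
have [||q hq] := root (m.1.2 - m.2) (0, n%:R^-1, - n%:R^-1).
- apply: (equivariant_Omega_y mH JU JV) => //.
  by exists (0, 1, -1); rewrite // /node /= mul0r mul1r mulN1r.
- by rewrite /dotH /= intrD intrN; field.
by exists p, q.
Qed.

(** If m = j - k is such that m1 - m3 = 3 n p and m2 - m3 = 3 n q, then, as m has
    sum 0, m = n (2 p - q, 2 q - p, - p - q).  The coordinates of a difference of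
    two elements of [indexH n] are smaller than 2 n in absolute value, which
    leaves only p = q = 0. *)
Lemma discrete_orthogonality n j k : (1 <= n)%N -> indexH n j -> indexH n k ->
  \sum_(i \in indexH n) phi (subZ3 j k) (node R n i) =
  if j == k then 3 * n%:R ^+ 2 else 0.
Proof.
move=> n1 hj hk; have [<-|jk] := eqVneq j k.
  rewrite -card_indexH; apply: eq_fsbigr => i _.
  by rewrite /subZ3 !subrr phi0.
apply/eqP; apply: contraNT jk => /(sum_phi_neq0 n1)[].
  by move: hj hk; rewrite !indexHE /latticeH /=; lia.
move=> p [q]; move: hj hk; rewrite !indexHE.
case: j k => -[j1 j2] j3 [[k1 k2] k3] /= [hj hj'] [hk hk'] [hp hq].
rewrite PoszM in hp hq.
have p1 : -2 < p < 2 by nia.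
have q1 : -2 < q < 2 by nia.
suff [-> -> ->] : [/\ j1 = k1, j2 = k2 & j3 = k3] by [].
have : (p = -1 \/ p = 0 \/ p = 1) /\ (q = -1 \/ q = 0 \/ q = 1) by lia.
by move=> [[ep|[ep|ep]] [eq|[eq|eq]]]; subst p q; split; lia.
Qed.

End Discrete.

(** * Translation invariance of the area and integration of characters *)

Section Area.
Variable R : realType.
Implicit Types (D : set (R3 R)).

(** Translations are named so that they can carry the structure of a measurable
    function, which makes the image of a measure a measure. *)
Definition shift1 (a x : measurableTypeR R) : measurableTypeR R := (x : R) + a.

Lemma measurable_shift1 a : measurable_fun setT (shift1 a).
Proof. exact: measurable_funD. Qed.

HB.instance Definition _ a :=
  isMeasurableFun.Build _ _ _ _ (shift1 a) (measurable_shift1 a).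

(** Lebesgue measure is determined by its values on half-open intervals. *)
Lemma lebesgue_measure_shift a (A : set (measurableTypeR R)) : measurable A ->
  @lebesgue_measure R (shift1 a @^-1` A) = @lebesgue_measure R A.
Proof.
move=> mA; apply/esym.
apply: (@lebesgue_measure_unique _
  (pushforward (@lebesgue_measure R)
    (shift1 a : {mfun measurableTypeR R >-> measurableTypeR R}))) => // X.
move=> [[x y] xy <-] /=; rewrite /pushforward.
have -> : shift1 a @^-1` `]x, y] = `]x - a, y - a]%classic.
  by apply/seteqP; split=> z /=; rewrite /shift1 !in_itv /= ltrBlDr lerBrDr.
rewrite !lebesgue_measure_itv /= !lte_fin ltrD2r.
by case: ifP => // _; rewrite -!EFinD; congr EFin; lra.
Qed.

Definition shift2 (w u : R2 R) : R2 R := (shift1 w.1 u.1, shift1 w.2 u.2).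

Lemma measurable_shift2 w : measurable_fun setT (shift2 w).
Proof. by apply: measurable_fun_pair; apply: measurableT_comp. Qed.

HB.instance Definition _ w :=
  isMeasurableFun.Build _ _ _ _ (shift2 w) (measurable_shift2 w).

Lemma lebesgue_measure2_shift w (A : set (R2 R)) : measurable A ->
  (@lebesgue_measure R \x @lebesgue_measure R)%E (shift2 w @^-1` A) =
  (@lebesgue_measure R \x @lebesgue_measure R)%E A.
Proof.
move=> mA; apply/esym.
apply: (@product_measure_unique _ _ _ _ _ (@lebesgue_measure R) (@lebesgue_measure R)
  (pushforward (@lebesgue_measure R \x @lebesgue_measure R)%E
    (shift2 w : {mfun R2 R >-> R2 R}))) => // B C mB mC.
rewrite /= /pushforward.
rewrite (_ : shift2 w @^-1` _ = (shift1 w.1 @^-1` B) `*` (shift1 w.2 @^-1` C))//.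
rewrite product_measure1E//; first by congr (_ * _)%E; apply: lebesgue_measure_shift.
- by rewrite -[X in measurable X]setTI; exact: measurable_shift1.
- by rewrite -[X in measurable X]setTI; exact: measurable_shift1.
Qed.

Lemma chart_shift2 w u : chart (shift2 w u) = addH (chart u) (chart w).
Proof. by rewrite /chart /addH /shift2 /shift1 /=; congr (_, _, _); ring. Qed.

(** [chart] is linear, so a translation of the plane [planeH] is read in the
    coordinates as a translation. *)
Lemma area_addH v D : planeH v -> measurable D ->
  @area R ([set t | D (addH t v)]) = @area R D.
Proof.
rewrite -range_chart => -[w _ <-] mD; rewrite /area /pushforward.
rewrite -[RHS](lebesgue_measure2_shift w); last first.
  by rewrite -[X in measurable X]setTI; exact: measurable_chart.
by congr (_ _); apply/seteqP; split=> u /=; rewrite chart_shift2.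
Qed.

Lemma lebesgue_measure2_rectangle (a b : R) : 0 <= a -> 0 <= b ->
  (@lebesgue_measure R \x @lebesgue_measure R)%E
    ((`[- a, a]%classic : set (measurableTypeR R)) `*`
     (`[- b, b]%classic : set (measurableTypeR R)))
  = (a * 2 * (b * 2))%:E.
Proof.
move=> a0 b0; rewrite product_measure1E; [|exact: measurable_itv..].
have len c : 0 <= c -> @lebesgue_measure R `[- c, c]%classic = (c * 2)%:E.
  move=> c0; rewrite lebesgue_measure_itv /= lte_fin.
  case: ifP => [_|h]; first by rewrite -EFinD; congr EFin; lra.
  by congr EFin; lra.
by rewrite EFinM; congr (_ * _)%E; exact: len.
Qed.

(** The rectangle on which the two numbers a and b in the definition of [chart]
    are at most c in absolute value; it is a diamond in terms of the first two
    components a + b and - a + b. *)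
Definition diamond (c : R) : set (R2 R) :=
  (`[- (c * Num.sqrt 2), c * Num.sqrt 2]%classic : set (measurableTypeR R)) `*`
  (`[- (c * Num.sqrt 6), c * Num.sqrt 6]%classic : set (measurableTypeR R)).

Lemma measurable_diamond c : measurable (diamond c).
Proof. by apply: measurableX; exact: measurable_itv. Qed.

Lemma diamondP c u : diamond c u <->
  (- c <= u.1 / Num.sqrt 2 <= c) /\ (- c <= u.2 / Num.sqrt 6 <= c).
Proof.
have s2 : 0 < Num.sqrt 2 :> R by rewrite sqrtr_gt0.
have s6 : 0 < Num.sqrt 6 :> R by rewrite sqrtr_gt0.
by rewrite /diamond /= !in_itv /= -!mulNr !ler_pdivlMr// !ler_pdivrMr.
Qed.

Lemma measure_diamond c : 0 <= c ->
  (@lebesgue_measure R \x @lebesgue_measure R)%E (diamond c) =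
  (c * Num.sqrt 2 * 2 * (c * Num.sqrt 6 * 2))%:E.
Proof. by move=> c0; rewrite lebesgue_measure2_rectangle// mulr_ge0// sqrtr_ge0. Qed.

Lemma measurable_preimage_chart D : measurable D -> measurable (@chart R @^-1` D).
Proof.
by move=> mD; rewrite -[X in measurable X]setTI; exact: measurable_chart.
Qed.

Lemma admissible_finite D : admissible D -> (@area R D < +oo)%E.
Proof.
move=> [mD _ Db].
have : (@area R D <= (@lebesgue_measure R \x @lebesgue_measure R)%E (diamond 3))%E.
  rewrite /area /pushforward; apply: le_measure; rewrite ?inE;
    first exact: measurable_preimage_chart.
    exact: measurable_diamond.
  move=> u /Db /andP[]; rewrite !ler_norml /chart /= => /andP[? ?] /andP[? ?].
  by apply/diamondP; split; lra.
by rewrite measure_diamond// => /le_lt_trans; apply; rewrite ltry.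
Qed.

Lemma area_Omega_gt0 : (0 < @area R (@Omega R))%E.
Proof.
(* Any c < 1/2 keeps a + b, - a + b and 2 b strictly between -1 and 1. *)
have : ((@lebesgue_measure R \x @lebesgue_measure R)%E (diamond 3^-1)
        <= @area R (@Omega R))%E.
  rewrite /area /pushforward; apply: le_measure; rewrite ?inE; first exact: measurable_diamond.
    by apply: measurable_preimage_chart; exact: measurable_Omega.
  move=> u /diamondP; rewrite /preimage /= OmegaE /chart /=.
  set x := u.1 / _; set y := u.2 / _; lra.
rewrite measure_diamond//; apply: lt_le_trans.
by rewrite lte_fin !mulr_gt0// sqrtr_gt0.
Qed.

Section Integrals.
Implicit Types (h : R3 R -> R[i]).

Definition Cintegrable D h :=
  (@area R).-integrable D (EFin \o (fun t => complex.Re (h t))) /\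
  (@area R).-integrable D (EFin \o (fun t => complex.Im (h t))).

Lemma measurable_dotH (m : Z3) : measurable_fun setT (fun t : R3 R => dotH m t).
Proof.
apply: measurable_funD; first apply: measurable_funD.
- by apply: measurable_funM => //; exact: measurable_x.
- by apply: measurable_funM => //; exact: measurable_y.
- by apply: measurable_funM => //; exact: measurable_z.
Qed.

Lemma bounded_integrable D (f : R3 R -> R) : admissible D ->
  measurable_fun setT f -> (forall t, `|f t| <= 1) ->
  (@area R).-integrable D (EFin \o f).
Proof.
move=> aD mf fb; case: (aD) => mD _ _; apply: measurable_bounded_integrable => //.
- exact: admissible_finite.
- exact: measurable_funS mf.
- by exists 1; split=> // M M1 x _; exact: le_trans (fb x) (ltW M1).
Qed.

Lemma measurable_angle m : measurable_fun setT (fun t : R3 R => 2 * pi / 3 * dotH m t : R).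
Proof. by apply: measurable_funM => //; exact: measurable_dotH. Qed.

Lemma measurable_Re_phi m : measurable_fun setT (fun t : R3 R => complex.Re (phi m t)).
Proof.
rewrite (_ : (fun t => _) = (fun t : R3 R => cos (2 * pi / 3 * dotH m t))).
  exact: (measurableT_comp (continuous_measurable_fun (@continuous_cos R)) (measurable_angle m)).
by apply/funext => t; rewrite phiE.
Qed.

Lemma measurable_Im_phi m : measurable_fun setT (fun t : R3 R => complex.Im (phi m t)).
Proof.
rewrite (_ : (fun t => _) = (fun t : R3 R => sin (2 * pi / 3 * dotH m t))).
  exact: (measurableT_comp (continuous_measurable_fun (@continuous_sin R)) (measurable_angle m)).
by apply/funext => t; rewrite phiE.
Qed.

Lemma Cintegrable_phi D m : admissible D -> Cintegrable D (phi m).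
Proof.
move=> aD; split; apply: bounded_integrable => //.
- exact: measurable_Re_phi.
- by move=> t; rewrite phiE /= ler_norml cos_geN1 cos_le1.
- exact: measurable_Im_phi.
- by move=> t; rewrite phiE /= ler_norml sin_geN1 sin_le1.
Qed.

Lemma CintegralU h D E : measurable D -> measurable E -> Cintegrable (D `|` E) h ->
  D `&` E `<=` set0 -> Cintegral (D `|` E) h = Cintegral D h + Cintegral E h.
Proof.
move=> mD mE [hr hi] DE; rewrite /Cintegral.
have dDE : [disjoint D & E] by rewrite disj_set2E; apply/eqP; rewrite -subset0.
by rewrite !Rintegral_setU//.
Qed.

Lemma CintegralD h1 h2 D : measurable D -> Cintegrable D h1 -> Cintegrable D h2 ->
  Cintegral D (fun t => h1 t + h2 t) = Cintegral D h1 + Cintegral D h2.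
Proof.
move=> mD [r1 i1] [r2 i2]; rewrite /Cintegral.
have -> : (fun t => complex.Re (h1 t + h2 t)) =
   (fun t => complex.Re (h1 t) + complex.Re (h2 t)).
  by apply/funext => t; case: (h1 t) (h2 t) => [? ?] [].
have -> : (fun t => complex.Im (h1 t + h2 t)) =
   (fun t => complex.Im (h1 t) + complex.Im (h2 t)).
  by apply/funext => t; case: (h1 t) (h2 t) => [? ?] [].
by rewrite !RintegralD.
Qed.

Lemma CintegralZ h (c : R[i]) D : measurable D -> Cintegrable D h ->
  Cintegral D (fun t => c * h t) = c * Cintegral D h.
Proof.
case: c => a b mD [hr hi]; rewrite /Cintegral.
have intZ (r : R) f : (@area R).-integrable D (EFin \o f) ->
    (@area R).-integrable D (EFin \o (fun t => r * f t)).
  by move=> hf; apply: eq_integrable (integrableZl mD r hf) => // t _ /=; rewrite EFinM.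
have -> : (fun t => complex.Re ((a +i* b) * h t)) =
   (fun t => a * complex.Re (h t) - b * complex.Im (h t)).
  by apply/funext => t; case: (h t).
have -> : (fun t => complex.Im ((a +i* b) * h t)) =
   (fun t => a * complex.Im (h t) + b * complex.Re (h t)).
  by apply/funext => t; case: (h t).
by rewrite RintegralB ?RintegralD ?RintegralZl//; exact: intZ.
Qed.

Lemma CintegrableD h1 h2 D : measurable D -> Cintegrable D h1 -> Cintegrable D h2 ->
  Cintegrable D (fun t => h1 t + h2 t).
Proof.
move=> mD [r1 i1] [r2 i2]; split.
  apply: eq_integrable (integrableD mD r1 r2) => // t _ /=.
  by case: (h1 t) (h2 t) => [? ?] [].
apply: eq_integrable (integrableD mD i1 i2) => // t _ /=.
by case: (h1 t) (h2 t) => [? ?] [].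
Qed.

Lemma CintegrableZ h (c : R[i]) D : measurable D -> Cintegrable D h ->
  Cintegrable D (fun t => c * h t).
Proof.
case: c => a b mD [hr hi]; split.
  apply: eq_integrable (integrableB mD (integrableZl mD a hr) (integrableZl mD b hi)) => // t _ /=.
  by case: (h t).
apply: eq_integrable (integrableD mD (integrableZl mD a hi) (integrableZl mD b hr)) => // t _ /=.
by case: (h t).
Qed.

Lemma Cintegral_sum (I : Type) (s : seq I) (c : I -> R[i]) (h : I -> R3 R -> R[i]) D :
  measurable D -> (forall i, Cintegrable D (h i)) ->
  Cintegrable D (fun t => \sum_(i <- s) c i * h i t) /\
  Cintegral D (fun t => \sum_(i <- s) c i * h i t) =
  \sum_(i <- s) c i * Cintegral D (h i).
Proof.
move=> mD ih; elim: s => [|i s [IH1 IH2]].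
  have -> : (fun t : R3 R => \sum_(i <- [::]) c i * h i t) = cst 0.
    by apply/funext => t; rewrite big_nil.
  rewrite big_nil; split; first by split; exact: integrable0.
  by rewrite /Cintegral !Rintegral_cst// !mul0r.
have -> : (fun t : R3 R => \sum_(j <- i :: s) c j * h j t) =
    (fun t => c i * h i t + \sum_(j <- s) c j * h j t).
  by apply/funext => t; rewrite big_cons.
have iZ := CintegrableZ (c i) mD (ih i).
split; first exact: CintegrableD.
by rewrite CintegralD// CintegralZ// IH2 big_cons.
Qed.

Lemma eq_Cintegral D h1 h2 : {in D, h1 =1 h2} -> Cintegral D h1 = Cintegral D h2.
Proof.
by move=> hh; rewrite /Cintegral; congr (_ +i* _); apply: eq_Rintegral => t /hh ->.
Qed.

Definition shiftH v (t : R3 R) : R3 R := addH t v.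

HB.instance Definition _ v :=
  isMeasurableFun.Build _ _ _ _ (shiftH v) (measurable_addH v : measurable_fun setT (shiftH v)).

Lemma Rintegral_addH v D (f : R3 R -> R) : planeH v -> measurable D ->
  measurable_fun setT f ->
  (@area R).-integrable D (EFin \o (fun t => f (addH t v))) ->
  Rintegral (@area R) D (fun t => f (addH t v)) =
  Rintegral (@area R) (translate v D) f.
Proof.
move=> vH mD mf fi; rewrite /Rintegral; congr fine.
have pre : shiftH v @^-1` translate v D = D.
  by apply/seteqP; split=> t; rewrite /translate /shiftH /= addH_opp.
rewrite -[in LHS]pre.
rewrite -(integral_pushforward (phi := shiftH v) (measurable_addH v) (f := EFin \o f)).
- apply: (eq_measure_integral (@area R)) => A mA _.
  by rewrite -[RHS](area_addH vH mA).
- exact/measurable_EFinP.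
- by rewrite pre.
- exact: measurable_translate.
Qed.

Lemma Cintegral_translate v D m : planeH v -> admissible D ->
  Cintegral (translate v D) (phi m) = phi m v * Cintegral D (phi m).
Proof.
move=> vH aD; have [mD _ _] := aD.
have ip := Cintegrable_phi m aD.
rewrite -CintegralZ//.
have -> : (fun t => phi m v * phi m t) = (fun t : R3 R => phi m (addH t v)).
  by apply/funext => t; rewrite phiD mulrC.
have iv : Cintegrable D (fun t : R3 R => phi m (addH t v)).
  have -> : (fun t : R3 R => phi m (addH t v)) = (fun t => phi m v * phi m t).
    by apply/funext => t; rewrite phiD mulrC.
  exact: CintegrableZ.
case: iv => ir ii.
rewrite /Cintegral; congr (_ +i* _); apply/esym.
  exact: (Rintegral_addH vH mD (measurable_Re_phi m)).
exact: (Rintegral_addH vH mD (measurable_Im_phi m)).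
Qed.

End Integrals.
End Area.

(** * Both inner products on products of characters *)

Section Mean.
Variable R : realType.
Implicit Types (m j k : Z3) (n : nat).

Lemma Cintegral_phi0 : Cintegral (@Omega R) (phi (0, 0, 0)) =
  (fine (area (@Omega R)))%:C.
Proof.
have -> : phi (0, 0, 0) = cst 1 :> (R3 R -> R[i]) by apply/funext => t; rewrite phi0.
have mO := @measurable_Omega R.
by rewrite /Cintegral !Rintegral_cst// mul1r mul0r.
Qed.

(** If m <> 0, one of p = m1 - m3 and p = m2 - m3 is nonzero, and a translation
    by sigma = 3 / (4 |p|) in the corresponding direction turns the character by
    a quarter of a circle. *)
Lemma Cintegral_phi m : latticeH m -> m != (0, 0, 0) ->
  Cintegral (@Omega R) (phi m) = 0.
Proof.
move=> mH m0; pose J D := @Cintegral R D (phi m).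
rewrite -/(J (@Omega R)).
have JU D E : admissible D -> admissible E -> D `&` E `<=` set0 ->
    J (D `|` E) = J D + J E.
  move=> aD aE DE; apply: CintegralU => //; [by case: aD|by case: aE|].
  apply: Cintegrable_phi; case: aD aE => [? h1 h2] [? h3 h4]; split.
  - exact: measurableU.
  - by move=> t [/h1|/h3].
  - by move=> t [/h2|/h4].
have JV v D : planeH v -> admissible D -> admissible (translate v D) ->
    J (translate v D) = phi m v * J D.
  by move=> vH aD _; exact: Cintegral_translate.
have pl1 : @planeH R (1, 1, -2) by rewrite /planeH /=; lra.
have pl2 : @planeH R (2, -1, -1) by rewrite /planeH /=; lra.
have pl3 : @planeH R (-1, 2, -1) by rewrite /planeH /=; lra.
have quarter (p : int) : p != 0 -> exists2 s : R, 0 <= s <= 1 &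
    cis (2 * pi / 3 * (p%:~R * s)) != 1.
  move=> p0; have pr : p%:~R != 0 :> R by rewrite intr_eq0.
  have np : 1 <= `|p%:~R : R| by rewrite -intr_norm ler1z; lia.
  exists (3 / 4 / `|p%:~R|).
    rewrite divr_ge0//= ler_pdivrMr ?mul1r; last by lra.
    by lra.
  have [|] := ltP 0 p => hp.
    rewrite gtr0_norm ?ltr0z// (_ : _ * _ = pi / 2); last by field.
    by rewrite /cis cos_pihalf; apply/eqP => -[/esym/eqP]; rewrite oner_eq0.
  rewrite ler0_norm ?lerz0// (_ : _ * _ = - (pi / 2)); last by field.
  by rewrite /cis cosN cos_pihalf; apply/eqP => -[/esym/eqP]; rewrite oner_eq0.
have cancel (v : R3 R) : phi m v * J (@Omega R) = J (@Omega R) -> phi m v != 1 ->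
    J (@Omega R) = 0.
  move=> h; apply: contraNeq => J0; apply/eqP/(mulIf J0).
  by rewrite h mul1r.
have [e1|/quarter[s s01 hs]] := eqVneq (m.1.1 - m.2) 0; last first.
  apply: (cancel (s, 0, - s)); first
    by apply: (equivariant_Omega_x mH JU JV) => //; rewrite /planeH /=; lra.
  rewrite phiE; apply: contraNneq hs => <-; apply/eqP; congr (cis (_ * _)).
  by rewrite /dotH /= intrD intrN; ring.
have [e2|/quarter[s s01 hs]] := eqVneq (m.1.2 - m.2) 0; last first.
  apply: (cancel (0, s, - s)); first
    by apply: (equivariant_Omega_y mH JU JV) => //; rewrite /planeH /=; lra.
  rewrite phiE; apply: contraNneq hs => <-; apply/eqP; congr (cis (_ * _)).
  by rewrite /dotH /= intrD intrN; ring.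
move: m0; suff -> : m = (0, 0, 0) by rewrite eqxx.
by move: mH e1 e2; case: m {J JU JV cancel} => -[a b] c; rewrite /latticeH /= => *;
  congr (_, _, _); lia.
Qed.

Lemma mean_phi j k : latticeH j -> latticeH k ->
  ((fine (area (@Omega R)))^-1)%:C * Cintegral (@Omega R) (phi (subZ3 j k)) =
  (j == k)%:R.
Proof.
move=> jH kH; have [<-|jk] := eqVneq j k.
  have -> : subZ3 j j = (0, 0, 0) by rewrite /subZ3 !subrr.
  rewrite Cintegral_phi0 -rmorphM mulVf ?rmorph1// gt_eqF// fine_gt0//.
  rewrite area_Omega_gt0 admissible_finite//.
  by apply: admissible_sub_Omega => //; exact: measurable_Omega.
rewrite Cintegral_phi ?mulr0//; first by move: jH kH; rewrite /latticeH /=; lia.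
apply: contraNneq jk; move: j k {jH kH} => [[a b] c] [[a' b'] c'].
by rewrite /subZ3 /= => -[? ? ?]; apply/eqP; congr (_, _, _); lia.
Qed.

Lemma discrete_mean_phi n j k : (1 <= n)%N -> indexH n j -> indexH n k ->
  1 / (3 * n%:R ^+ 2) * \sum_(i \in indexH n) phi (subZ3 j k) (node R n i)
  = (j == k)%:R.
Proof.
move=> n1 hj hk; rewrite discrete_orthogonality//.
case: ifP => _; last by rewrite mulr0.
rewrite mul1r mulVf// mulf_neq0 ?expf_neq0 ?pnatr_eq0//.
by rewrite -lt0n.
Qed.

Lemma trigH_mul_conj n (f g : R3 R -> R[i]) : trigH n f -> trigH n g ->
  exists s : seq (Z3 * Z3), exists c : Z3 * Z3 -> R[i],
   (forall p, p \in s -> indexH n p.1 /\ indexH n p.2) /\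
   forall t, planeH t ->
     f t * Num.conj (g t) = \sum_(p <- s) c p * phi (subZ3 p.1 p.2) t.
Proof.
move=> [a fE] [b gE]; have fin := finite_indexH n.
pose r : seq Z3 := finmap.enum_fset (fset_set (indexH n)).
exists [seq (j, k) | j <- r, k <- r], (fun p => a p.1 * Num.conj (b p.2)); split.
  move=> [j k] /allpairsP[[j' k'] /= [hj hk [-> ->]]].
  by move: hj hk; rewrite !in_fset_set// !inE.
move=> t tH; rewrite fE// gE// !fsbig_finite//= rmorph_sum big_distrlr big_allpairs /=.
apply: eq_bigr => j _; apply: eq_bigr => k _.
by rewrite rmorphM -phi_mul_conj mulrACA.
Qed.

Lemma innerH_eq_innern n (f g : R3 R -> R[i]) : (1 <= n)%N ->
  trigH n f -> trigH n g -> innerH f g = innern n f g.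
Proof.
move=> n1 fH gH; have [s [c [sP fgE]]] := trigH_mul_conj fH gH.
have aO : admissible (@Omega R).
  by apply: admissible_sub_Omega => //; exact: measurable_Omega.
transitivity (\sum_(p <- s) c p * (p.1 == p.2)%:R).
  rewrite /innerH (@eq_Cintegral _ _ _ (fun t => \sum_(p <- s) c p * phi (subZ3 p.1 p.2) t)).
    have [_ ->] := Cintegral_sum s c (@measurable_Omega R)
      (fun p : Z3 * Z3 => Cintegrable_phi (subZ3 p.1 p.2) aO).
    rewrite mulr_sumr; apply: eq_big_seq => p /sP[h1 h2].
    by rewrite mulrCA mean_phi//; [case: h1|case: h2].
  by move=> t; rewrite inE => -[tH _]; exact: fgE.
rewrite /innern.
have -> : \sum_(i \in indexH n) f (node R n i) * Num.conj (g (node R n i)) =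
    \sum_(i \in indexH n) \sum_(p <- s) c p * phi (subZ3 p.1 p.2) (node R n i).
  by apply: eq_fsbigr => i; rewrite inE => -[iH _]; rewrite fgE//; exact: nodeH.
rewrite fsbig_finite; last exact: finite_indexH.
rewrite exchange_big mulr_sumr; apply: eq_big_seq => p /sP[h1 h2] /=.
rewrite -(discrete_mean_phi n1 h1 h2) fsbig_finite; last exact: finite_indexH.
by rewrite -mulr_sumr mulrCA.
Qed.

End Mean.

(** * The symmetric quadrature *)

Section Star.
Variables (R : realType) (n : nat).
Hypothesis n1 : (1 <= n)%N.
Implicit Types (j k l : Z3).

(** The weight extended by 0, so that it can be summed over a whole class of
    equivalent points. *)
Definition weight0 j : R[i] := if j \in indexH_star n then weight R n j else 0.

Let starP j : latticeH j -> (j \in indexH_star n) =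
  [&& - n%:Z <= j.1.1 <= n%:Z, - n%:Z <= j.1.2 <= n%:Z & - n%:Z <= j.2 <= n%:Z].
Proof.
move=> jH; apply/idP/idP; rewrite inE; first by case=> _ [-> -> ->].
by move=> /and3P[*].
Qed.

Let openP j : latticeH j -> (j \in indexH_open n) =
  [&& - n%:Z < j.1.1 < n%:Z, - n%:Z < j.1.2 < n%:Z & - n%:Z < j.2 < n%:Z].
Proof.
move=> jH; apply/idP/idP; rewrite inE; first by case=> _ [-> -> ->].
by move=> /and3P[*].
Qed.

Lemma weight0E j : latticeH j -> weight0 j =
  if [&& - n%:Z <= j.1.1 <= n%:Z, - n%:Z <= j.1.2 <= n%:Z & - n%:Z <= j.2 <= n%:Z]
  then if [&& - n%:Z < j.1.1 < n%:Z, - n%:Z < j.1.2 < n%:Z & - n%:Z < j.2 < n%:Z]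
       then 1
       else if [&& j.1.1 != 0, j.1.2 != 0 & j.2 != 0] then 1 / 2 else 1 / 3
  else 0.
Proof.
move=> jH; rewrite /weight0 /weight starP// openP// !mulf_eq0 !negb_or.
by rewrite -!andbA.
Qed.

Definition period1 : Z3 := (2 * n%:Z, - n%:Z, - n%:Z).
Definition period2 : Z3 := (- n%:Z, 2 * n%:Z, - n%:Z).
Definition period3 : Z3 := (n%:Z, n%:Z, - (2 * n%:Z)).

(** The other points equivalent to k have weight 0: an interior point is alone
    with weight 1, a boundary point that is not a vertex has one partner, on the
    opposite edge, and a vertex has two, since the vertices form two classes of
    three. *)
Lemma weight0_sum k : indexH n k ->
  weight0 k + (weight0 (addZ3 k period1) +
    (weight0 (addZ3 k period2) + weight0 (addZ3 k period3))) = 1.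
Proof.
rewrite indexHE => -[kH hk].
rewrite !weight0E; [|by move: kH; rewrite /latticeH /addZ3 /=; lia..].
move: kH hk; case: k => -[a b] c /= kH hk.
have F1 (X : bool) (u v : R[i]) : X -> (if X then u else v) = u by move=> ->.
have F0 (X : bool) (u v : R[i]) : ~~ X -> (if X then u else v) = v by move=> /negbTE ->.
have n0 : 0 < n%:Z by lia.
(* The points of [indexH n] on the boundary are those with a = -n, b = -n or
   c = n; two of these equalities hold at the two vertices. *)
have [ea|ea] := eqVneq a (- n%:Z); have [eb|eb] := eqVneq b (- n%:Z);
  have [ec|ec] := eqVneq c n%:Z; try by exfalso; lia.
all: by do ?[rewrite F1; last by lia|rewrite F0; last by lia]; field.
Qed.

(** The part of the closed hexagon that the translation by l brings from
    [indexH n]. *)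
Definition star_piece l : set Z3 := [set j | indexH_star n j /\ indexH n (subZ3 j l)].

Lemma addZ3K j l : subZ3 (addZ3 j l) l = j.
Proof. by case: j => -[a b] c; rewrite /subZ3 /addZ3 /= !addrK. Qed.

Lemma subZ3K j l : addZ3 (subZ3 j l) l = j.
Proof. by case: j => -[a b] c; rewrite /subZ3 /addZ3 /= !subrK. Qed.

Lemma finite_star_piece l : finite_set (star_piece l).
Proof. by apply: sub_finite_set (finite_indexH_star n) => j []. Qed.

Lemma sum_star_piece (F : Z3 -> R[i]) l :
  (forall j, latticeH j -> F (addZ3 j l) = F j) ->
  \sum_(j \in star_piece l) weight R n j * F j =
  \sum_(k \in indexH n) weight0 (addZ3 k l) * F k.
Proof.
move=> Fl.
rewrite (reindex_fsbig (fun k => addZ3 k l)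
  (indexH n `&` [set k | indexH_star n (addZ3 k l)])); last first.
  split.
  - by move=> k /= [hk hs]; rewrite /star_piece /= addZ3K.
  - by move=> j k _ _ e; rewrite -(addZ3K j l) e addZ3K.
  - by move=> j [hs hj]; exists (subZ3 j l); rewrite /= subZ3K.
rewrite fsbig_mkcondr; apply: eq_fsbigr => k; rewrite inE => -[kH _].
rewrite /weight0 Fl//.
have -> : (k \in [set k | indexH_star n (addZ3 k l)]) = (addZ3 k l \in indexH_star n).
  by apply/idP/idP; rewrite !inE.
by case: ifP; rewrite ?mul0r.
Qed.

(** The closed hexagon is cut into four pieces.  The edges with third coordinate
    -n, first coordinate n, and second coordinate n, in this order of priority
    at the vertices they share, come from [indexH n] by the periods 3, 1 and 2. *)
Lemma sum_star (F : Z3 -> R[i]) :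
  (forall j, latticeH j -> F (addZ3 j period1) = F j) ->
  (forall j, latticeH j -> F (addZ3 j period2) = F j) ->
  (forall j, latticeH j -> F (addZ3 j period3) = F j) ->
  \sum_(j \in indexH_star n) weight R n j * F j = \sum_(j \in indexH n) F j.
Proof.
move=> F1 F2 F3; pose period0 : Z3 := (0, 0, 0).
have add0 j : addZ3 j period0 = j.
  by case: j => -[a b] c; rewrite /addZ3 /= !addr0.
have cover : indexH_star n = star_piece period0 `|` (star_piece period1 `|`
    (star_piece period2 `|` star_piece period3)).
  apply/seteqP; split=> j; last by case=> [[]|[[]|[[]|[]]]].
  move=> sj; move: (sj) => [jH]; rewrite /star_piece /= !indexHE /=.
  move: sj jH; case: j => -[a b] c sj; rewrite /latticeH /= => jH [h1 h2 h3].
  have [ec|ec] := eqVneq c (- n%:Z); first by right; right; right; split=> //; lia.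
  have [ea|ea] := eqVneq a n%:Z; first by right; left; split=> //; lia.
  have [eb|eb] := eqVneq b n%:Z; first by right; right; left; split=> //; lia.
  by left; split=> //; lia.
have d j : [/\ star_piece period0 j -> star_piece period1 j -> False,
    star_piece period0 j -> star_piece period2 j -> False &
    star_piece period0 j -> star_piece period3 j -> False] /\
   [/\ star_piece period1 j -> star_piece period2 j -> False,
    star_piece period1 j -> star_piece period3 j -> False &
    star_piece period2 j -> star_piece period3 j -> False].
  by rewrite /star_piece /= !indexHE /=; split; split=> -[_ h1] [_ h2]; lia.
have fin := finite_star_piece.
rewrite cover !fsbigU0; do ?[by rewrite ?finite_setU; do ?split; exact: fin].
- rewrite !sum_star_piece => //; last by move=> j _; rewrite add0.
  rewrite -!fsbig_split; do ?exact: finite_indexH.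
  apply: eq_fsbigr => k; rewrite inE => hk.
  by rewrite /= -!mulrDl add0 weight0_sum// mul1r.
- by move=> j [h2 h3]; case: (d j) => _ [_ _]; exact.
- by move=> j [h1 h]; case: (d j) => _ [d12 d13 _]; case: h; [exact: d12|exact: d13].
- by move=> j [h0 h]; case: (d j) => -[d01 d02 d03] _;
    case: h => [|[]]; [exact: d01|exact: d02|exact: d03].
Qed.

End Star.

Lemma innern_eq_star (R : realType) n (f g : R3 R -> R[i]) : (1 <= n)%N ->
  trigH n f -> trigH n g -> innern n f g = innern_star n f g.
Proof.
move=> n1 fH gH; rewrite /innern /innern_star; congr (_ * _).
have nr : n%:R != 0 :> R by rewrite pnatr_eq0 -lt0n.
have [s [c [sP fgE]]] := trigH_mul_conj fH gH.
pose F (j : Z3) : R[i] := f (node R n j) * Num.conj (g (node R n j)).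
have Fper l v : latticeH l -> node R n l = v :> R3 R ->
    (forall m, latticeH m -> phi m v = 1) ->
    forall j, latticeH j -> F (addZ3 j l) = F j.
  move=> lH <- hv j jH; rewrite /F !fgE; [|exact: nodeH|]; last first.
    by apply: nodeH; move: jH lH; rewrite /latticeH /=; lia.
  apply: eq_big_seq => p /sP[[h1 _] [h2 _]].
  rewrite node_add phiD hv ?mulr1//.
  by move: h1 h2; rewrite /latticeH /=; lia.
transitivity (\sum_(j \in indexH_star n) weight R n j * F j); last first.
  by apply: eq_fsbigr => j _; rewrite mulrA.
apply/esym/sum_star => //.
- apply: (Fper _ (2, -1, -1)); [by rewrite /latticeH /=; lia| |exact: phi_period1].
  by rewrite /node /= !intrN !intrM; congr (_, _, _); field.
- apply: (Fper _ (-1, 2, -1)); [by rewrite /latticeH /=; lia| |exact: phi_period2].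
  by rewrite /node /= !intrN !intrM; congr (_, _, _); field.
- apply: (Fper _ (1, 1, -2)); [by rewrite /latticeH /=; lia| |exact: phi_period3].
  by rewrite /node /= !intrN !intrM; congr (_, _, _); field.
Qed.

Theorem theorem3p3 (R : realType) (n : nat) (n_ge1 : (1 <= n)%N)
    (f g : R3 R -> complex R) (fH : trigH n f) (gH : trigH n g) :
  innerH f g = innern n f g /\ innern n f g = innern_star n f g.
Proof.
by split; [exact: innerH_eq_innern|exact: innern_eq_star].
Qed.
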